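(* Let $\alpha>0$, $\beta\in[0,1)$, $s\ge 0$ and $x_0\in\mathbb{R}^d$. Consider the iterates $(x_k)_{k\ge0}$ of the stochastic unified momentum (SUM) method with parameters $(\alpha,\beta,s)$ started at $x_0$, using the stochastic gradient oracle $\mathcal G(\cdot;\xi_k)$ at step $k$. Then SUM reduces to the following three methods (started at the same $x_0$ and using the same oracle and random variables $\xi_k$): (i) if $s=\frac{1}{1-\beta}$, SUM is the stochastic gradient (SG) method with step size $\frac{\alpha}{1-\beta}$, i.e. $x_{k+1}=x_k-\frac{\alpha}{1-\beta}\mathcal G(x_k;\xi_k)$ for all $k\ge 0$; (ii) if $s=0$, SUM is the stochastic heavy-ball (SHB) method, i.e. $x_{k+1}=x_k-\alpha\,\mathcal G(x_k;\xi_k)+\beta(x_k-x_{k-1})$ for all $k\ge0$, with $x_{-1}=x_0$; (iii) if $s=1$, SUM is the stochastic Nesterov accelerated gradient (SNAG) method, i.e. $y_{k+1}=x_k-\alpha\,\mathcal G(x_k;\xi_k)$ and $x_{k+1}=y_{k+1}+\beta(y_{k+1}-y_k)$ for all $k\ge 0$, with $y_0=x_0$.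
   Context: $\mathcal G(x;\xi)\in\mathbb{R}^d$ denotes a stochastic gradient at $x\in\mathbb{R}^d$ of a differentiable function $f:\mathbb{R}^d\to\mathbb{R}$, depending on a random variable $\xi$; $\xi_k$ is the random variable used at step $k$. The SUM method with parameters $\alpha>0$, $\beta\in[0,1)$, $s\ge0$ and starting point $x_0$ is: set $y^s_0=x_0$ and for $k\ge 0$ $$y_{k+1}=x_k-\alpha\,\mathcal G(x_k;\xi_k),\qquad y^s_{k+1}=x_k-s\alpha\,\mathcal G(x_k;\xi_k),\qquad x_{k+1}=y_{k+1}+\beta\,(y^s_{k+1}-y^s_k).$$ *)

(* Defs.v *)
From mathcomp Require Export all_boot all_order all_algebra.
From mathcomp Require Export all_classical all_reals all_analysis.

Set Implicit Arguments.
Unset Strict Implicit.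
Unset Printing Implicit Defensive.

Import Order.TTheory GRing.Theory Num.Theory.
Local Open Scope ring_scope.

(* Each predicate says that the process x consists of the iterates of a method
   started at the deterministic point x0; the recursions are required to hold
   for every outcome w of the sample space. The oracle G is an arbitrary map:
   no unbiasedness (or other link between G and an objective) is required. *)
Section Methods.
Context (dO dX : measure_display) (Omega : measurableType dO)
  (Xi : measurableType dX) (R : realType) (P : probability Omega R) (d : nat).
Context (G : 'rV[R]_d -> Xi -> 'rV[R]_d) (xi : nat -> {RV P >-> Xi}).
Implicit Types x y ys : nat -> Omega -> 'rV[R]_d.

(* ys stands for y^s; y 0 is deliberately left free, as SUM never uses it. *)
Definition is_SUM (alpha beta s : R) (x0 : 'rV[R]_d) x : Prop :=
  exists y ys,
    (forall w, x 0%N w = x0) /\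
    (forall w, ys 0%N w = x0) /\
    (forall k w,
       [/\ y k.+1 w = x k w - alpha *: G (x k w) (xi k w),
           ys k.+1 w = x k w - (s * alpha) *: G (x k w) (xi k w)
         & x k.+1 w = y k.+1 w + beta *: (ys k.+1 w - ys k w)]).

Definition is_SG (eta : R) (x0 : 'rV[R]_d) x : Prop :=
  (forall w, x 0%N w = x0) /\
  (forall k w, x k.+1 w = x k w - eta *: G (x k w) (xi k w)).

(* Since 0.-1 = 0, the term x k.-1 is x_{k-1} with the convention x_{-1} = x0. *)
Definition is_SHB (alpha beta : R) (x0 : 'rV[R]_d) x : Prop :=
  (forall w, x 0%N w = x0) /\
  (forall k w,
     x k.+1 w = x k w - alpha *: G (x k w) (xi k w)
                + beta *: (x k w - x k.-1 w)).

Definition is_SNAG (alpha beta : R) (x0 : 'rV[R]_d) x : Prop :=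
  exists y,
    (forall w, x 0%N w = x0) /\
    (forall w, y 0%N w = x0) /\
    (forall k w,
       y k.+1 w = x k w - alpha *: G (x k w) (xi k w) /\
       x k.+1 w = y k.+1 w + beta *: (y k.+1 w - y k w)).

End Methods.

(* Main.v *)
Require Import Defs.
From mathcomp Require Import ring.
Import Order.TTheory GRing.Theory Num.Theory.
Local Open Scope ring_scope.

(** The momentum term sees the past only through y^s, and each special [s] makes y^s_k a familiar
    sequence: x_k, x_{k-1} or y_k. Substituting it into the update of x gives SG, SHB or SNAG,
    outcome by outcome. *)

Theorem proposition1 (dO dX : measure_display) (Omega : measurableType dO)
    (Xi : measurableType dX) (R : realType) (P : probability Omega R) (d : nat)
    (G : 'rV[R]_d -> Xi -> 'rV[R]_d) (xi : nat -> {RV P >-> Xi})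
    (alpha beta s : R) (x0 : 'rV[R]_d) (x : nat -> Omega -> 'rV[R]_d)
    (halpha : 0 < alpha) (hbeta0 : 0 <= beta) (hbeta1 : beta < 1)
    (hs : 0 <= s)
    (hSUM : is_SUM G xi alpha beta s x0 x) :
  [/\ s = 1 / (1 - beta) -> is_SG G xi (alpha / (1 - beta)) x0 x,
      s = 0 -> is_SHB G xi alpha beta x0 x
    & s = 1 -> is_SNAG G xi alpha beta x0 x].
Proof.
case: hSUM => y [ys [hx0 [hys0 hstep]]]; split => hs_eq.
- have hne : 1 - beta != 0 by rewrite subr_eq0 eq_sym lt_eqF.
  have hsfix : 1 + beta * s = s by rewrite hs_eq; field.
  (* s = 1 / (1 - beta) is the fixed point of s = 1 + beta s, which keeps
     y^s_k equal to x_k. *)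
  have hys k w : ys k w = x k w.
    elim: k => [|k IHk]; first by rewrite hys0 hx0.
    have [hy1 hys1 hx1] := hstep k w.
    (* Expanding only the left-hand [s] makes both sides x_k - (1 + beta s) alpha G. *)
    rewrite hx1 hy1 hys1 IHk -{1}hsfix.
    by apply/rowP => i; rewrite !mxE; ring.
  split=> // k w; have [_ hys1 _] := hstep k w.
  by rewrite -hys hys1 hs_eq mul1r mulrC.
(* With [s = 0] the y^s step has no gradient; at k = 0 this is the convention x_{-1} = x_0. *)
- have hys k w : ys k w = x k.-1 w.
    case: k => [|k] /=; first by rewrite hys0 hx0.
    by have [_ -> _] := hstep k w; rewrite hs_eq mul0r scale0r subr0.
  split=> // k w; have [hy1 _ hx1] := hstep k w.
  by rewrite hx1 hy1 !hys.
(* The witness is [ys], not [y]: they agree from index 1 on, but only [ys] is known to start at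
   [x0]. *)
- exists ys; split=> //; split=> // k w; have [hy1 hys1 hx1] := hstep k w.
  have hyE : y k.+1 w = ys k.+1 w by rewrite hy1 hys1 hs_eq mul1r.
  by split; rewrite -?hyE // hx1 hyE.
Qed.
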